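(* Let $X=(X,\mu)$ be a probability space with finitely many points. The concentration function $\alpha$ of the automorphism group $\mathrm{Aut}^\ast(X,\mu)$, equipped with the uniform metric $$d_{unif}(\tau,\sigma)=\mu\{x\in X: \tau(x)\neq\sigma(x)\}$$ and the normalized counting measure, satisfies for every $\varepsilon>0$ $$\alpha(\varepsilon)\le \exp\left(-\frac{\varepsilon^2}{32\sum_{x\in X}\mu(\{x\})^2}\right).$$
   Context: $\mathrm{Aut}^\ast(X,\mu)$ is the group of all invertible measurable non-singular (null-set preserving in both directions) transformations of $X$, transformations agreeing $\mu$-a.e. being identified; if $\mu$ has full support this is just the group of all permutations of the finite set $X$. For a metric space with Borel probability measure $(Y,d,\nu)$, the concentration function is $\alpha_Y(0)=\frac12$ and, for $\varepsilon>0$, $\alpha_Y(\varepsilon)=1-\inf\{\nu(A_\varepsilon): A\subseteq Y \text{ Borel},\ \nu(A)\ge\frac12\}$, where $A_\varepsilon=\{y: \exists a\in A,\ d(y,a)<\varepsilon\}$ is the $\varepsilon$-neighbourhood of $A$. *)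

(* Defs.v *)
From HB Require Import structures.
From mathcomp Require Import all_boot all_order all_algebra all_fingroup finmap.
From mathcomp Require Import all_classical all_reals all_analysis.
From mathcomp Require Import generic_quotient.

Set Implicit Arguments.
Unset Strict Implicit.
Unset Printing Implicit Defensive.

Import Order.TTheory GRing.Theory Num.Theory.

Local Open Scope classical_set_scope.
Local Open Scope ring_scope.
Local Open Scope quotient_scope.

HB.mixin Record Measurable_hasSet1 (d : measure_display) T
    & Measurable d T & Finite T := {
  finmeasurable1 : forall x : T, measurable ([set x] : set T) }.

(* Finite sets in which all points are measurable; hence all subsets are
   (lemma finmeasurable), as are all self-maps. *)
#[short(type="finMeasurableType")]
HB.structure Definition FinMeasurable (d : measure_display) :=
  {T of Finite T & Measurable d T & Measurable_hasSet1 d T}.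

#[short(type="pmetricType")]
HB.structure Definition PMetric (K : numDomainType) :=
  {T of Pointed T & Metric K T}.

(* A metric space with its Borel sigma-algebra. *)
Definition borel (R : realType) (Y : pmetricType R) :=
  g_sigma_algebraType (@open Y).

Section concentration.
Context (R : realType) (Y : pmetricType R).

Definition eps_nbhd (A : set Y) (e : R) : set Y :=
  [set y | exists2 a, A a & mdist y a < e].

(* Only meaningful for 0 <= e. The infimum is over a set of reals in [0, 1]
   which contains nu (eps_nbhd setT e). *)
Definition concentration (nu : probability (borel Y) R) (e : R) : R :=
  if e == 0 then 2^-1 else
  1 - inf [set fine (nu (eps_nbhd A e)) |
             A in [set A : set (borel Y) |
                     measurable A /\ (2^-1%:E <= nu A)%E]].

End concentration.

Lemma finmeasurable d (X : finMeasurableType d) (A : set X) : measurable A.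
Proof.
rewrite -[A]image_id -bigcup_imset1.
apply: fin_bigcup_measurable; first exact: finite_finset.
by move=> x _; exact: finmeasurable1.
Qed.

Section nonsingular.
Context (R : realType) (d : measure_display) (X : finMeasurableType d).
Variable mu : probability X R.

(* Invertible self-maps of X are permutations; s and s^-1 are measurable. *)
Definition nonsingular : pred {perm X} := fun s =>
  `[< forall A : set X, measurable A -> mu (s @^-1` A) = 0%E <-> mu A = 0%E >].

Definition nonsing : Type := {s : {perm X} | nonsingular s}.
HB.instance Definition _ := Finite.on nonsing.

Definition nonsing_fun (s : nonsing) : X -> X := val s.

Definition ae_eq_op (s t : nonsing) : bool :=
  `[< nonsing_fun s = nonsing_fun t %[ae mu] >].

Let ae_refl : reflexive ae_eq_op.
Proof. by move=> s; apply/asboolP; exact: ae_eq_refl. Qed.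

Let ae_sym : symmetric ae_eq_op.
Proof. by move=> s t; apply/asboolP/asboolP => /ae_eq_sym. Qed.

Let ae_trans : transitive ae_eq_op.
Proof.
by move=> t s u /asboolP st /asboolP tu; apply/asboolP/(ae_eq_trans st).
Qed.

Canonical ae_eq_equiv := EquivRel ae_eq_op ae_refl ae_sym ae_trans.

(* The underlying set of Aut^*(X, mu); the group law is not needed to state the
   concentration of the metric measure space (Autstar, dunif, counting). *)
Definition Autstar : Type := {eq_quot ae_eq_op}.

HB.instance Definition _ := Choice.on Autstar.
HB.instance Definition _ := EqQuotient.on Autstar.
HB.instance Definition _ := Countable.on Autstar.

Let Autstar_enumP : Finite.axiom (undup [seq \pi_Autstar s | s <- enum {: nonsing}]).
Proof.
move=> a; rewrite count_uniq_mem ?undup_uniq // mem_undup.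
by rewrite -[a]reprK map_f // mem_enum.
Qed.

HB.instance Definition _ := fintype.isFinite.Build Autstar Autstar_enumP.

(* Well defined on classes by dunif_pi. *)
Definition dunif (a b : Autstar) : R :=
  fine (mu [set x | nonsing_fun (repr a) x != nonsing_fun (repr b) x]).

Lemma Autstar_eqP (s t : nonsing) :
  (\pi_Autstar s = \pi_Autstar t) <-> nonsing_fun s = nonsing_fun t %[ae mu].
Proof.
by split=> [/eqmodP/asboolP//|st]; apply/eqmodP/asboolP.
Qed.

Lemma ae_disagree (s t : nonsing) : nonsing_fun s = nonsing_fun t %[ae mu] <->
  mu [set x | nonsing_fun s x != nonsing_fun t x] = 0%E.
Proof.
have -> : [set x | nonsing_fun s x != nonsing_fun t x] =
          ~` [set x | setT x -> nonsing_fun s x = nonsing_fun t x].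
  apply/seteqP; split=> x /= => [/eqP st /(_ I)//|st].
  by apply/eqP => e; apply: st.
by split=> /negligibleP h; apply: h; exact: finmeasurable.
Qed.

Let fmuK (A : set X) : (fine (mu A))%:E = mu A.
Proof. by rewrite fineK // fin_num_measure //; exact: finmeasurable. Qed.

Lemma dunif_pi (s t : nonsing) : dunif (\pi s) (\pi t) =
  fine (mu [set x | nonsing_fun s x != nonsing_fun t x]).
Proof.
have h u : nonsing_fun (repr (\pi_Autstar u)) = nonsing_fun u %[ae mu].
  by apply/Autstar_eqP; rewrite reprK.
rewrite /dunif; congr fine.
set A := [set x | _]; set B := [set x | _].
have le (s1 t1 s2 t2 : nonsing) : nonsing_fun s1 = nonsing_fun s2 %[ae mu] ->
    nonsing_fun t1 = nonsing_fun t2 %[ae mu] ->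
    (mu [set x | nonsing_fun s1 x != nonsing_fun t1 x] <=
     mu [set x | nonsing_fun s2 x != nonsing_fun t2 x])%E.
  move=> /ae_disagree hs /ae_disagree ht.
  set C := [set x | nonsing_fun s1 x != nonsing_fun s2 x] in hs.
  set D := [set x | nonsing_fun t1 x != nonsing_fun t2 x] in ht.
  set E := [set x | nonsing_fun s2 x != nonsing_fun t2 x].
  have sub : [set x | nonsing_fun s1 x != nonsing_fun t1 x] `<=` E `|` (C `|` D).
    move=> x /= st; rewrite /E /C /D /=.
    have [e2|] := eqVneq (nonsing_fun s2 x) (nonsing_fun t2 x); last by left.
    right; have [e1|] := eqVneq (nonsing_fun s1 x) (nonsing_fun s2 x); last by left.
    by right; rewrite -e2 -e1 eq_sym.
  apply: (le_trans (le_measure _ _ _ sub)); rewrite ?inE; try exact: finmeasurable.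
  apply: (le_trans (measureU2 _ _ _)); try exact: finmeasurable.
  rewrite -[leRHS]adde0 leeD2l //.
  apply: (le_trans (measureU2 _ _ _)); try exact: finmeasurable.
  have le0 z : z = 0%E -> (z <= 0 :> \bar R)%E by move=> ->.
  by apply: adde_le0; apply: le0; [exact: hs|exact: ht].
apply: le_anti; apply/andP; split; first exact: le (h s) (h t).
by apply: le; apply: ae_eq_sym; exact: h.
Qed.

Let dunifxx a : dunif a a = 0.
Proof.
rewrite /dunif (_ : [set x | _] = set0) ?measure0 //.
by apply/seteqP; split=> x //=; rewrite eqxx.
Qed.

Let dunif_positivity a b : dunif a b = 0 -> a = b.
Proof.
move=> ab0; rewrite -(reprK a) -(reprK b); apply/Autstar_eqP/ae_disagree.
by rewrite -fmuK; congr EFin.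
Qed.

Let dunif_sym a b : dunif a b = dunif b a.
Proof. by rewrite /dunif; under eq_set do rewrite eq_sym. Qed.

Let dunif_triangle b a c : dunif a c <= dunif a b + dunif b c.
Proof.
rewrite -lee_fin EFinD /dunif !fmuK.
apply: le_trans (measureU2 _ _ _); try exact: finmeasurable.
apply: le_measure; rewrite ?inE; try exact: finmeasurable.
move=> x /= ac; have [ab|] := eqVneq (nonsing_fun (repr a) x) (nonsing_fun (repr b) x).
  by right; rewrite -ab.
by left.
Qed.

HB.instance Definition _ :=
  @isMetric.Build R Autstar dunif dunifxx dunif_positivity dunif_sym dunif_triangle.

Lemma nonsingular1 : nonsingular 1%g.
Proof.
apply/asboolP => A _; suff -> : (1%g : {perm X}) @^-1` A = A by [].
by apply/seteqP; split=> x /=; rewrite perm1.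
Qed.

HB.instance Definition _ := isPointed.Build Autstar 
  (\pi_Autstar (exist _ 1%g nonsingular1 : nonsing)).

Let invcard_ge0 : 0 <= (#|{: Autstar}|%:R^-1 : R).
Proof. by rewrite invr_ge0. Qed.

Definition normalized_counting : set (borel Autstar) -> \bar R :=
  mscale (NngNum invcard_ge0)
    (@counting (borel Autstar) R : {measure set (borel Autstar) -> \bar R}).

HB.instance Definition _ := Measure.on normalized_counting.

Let normalized_countingT : normalized_counting setT = 1%E.
Proof.
rewrite /normalized_counting /mscale /= /counting asboolT; last exact: finite_finset.
rewrite -EFinM; congr EFin.
have -> : #|` fset_set [set: Autstar]| = #|{: Autstar}|.
  rewrite cardE; apply/perm_size/uniq_perm; rewrite ?enum_uniq ?fset_uniq //.
  by move=> a; rewrite mem_enum in_fset_set ?in_setT ?inE //; exact: finite_finset.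
by rewrite (@mulVf R) // pnatr_eq0 -lt0n; apply/card_gt0P; exists point.
Qed.

HB.instance Definition _ := Measure_isProbability.Build _ _ _
  normalized_counting normalized_countingT.

End nonsingular.

Arguments normalized_counting {R d X} mu _.

(* Main.v *)
(** Null points play no role, so [Aut^*(X, mu)] is the symmetric group of the
    support with the weighted Hamming metric.  For a 1-Lipschitz [g] the product
    of the exponential moments of [l g] and [- l g] is at most
    [exp (4 l^2 sum mu^2)]: induct on the support, removing a point [x] of
    maximal mass.  Composing with a transposition maps the fibre over one value
    of [x] to the fibre over another, and moves points by at most [2 mu x]
    because the other point disturbed is no heavier than [x]; hence the
    exponential moments over the fibres have ratios in [[exp (- b), exp b]]
    with [b = 2 l (mu x)], and [cosh b <= exp (b^2)].  Applied to the
    (truncated) distance to [A] with [l = e / (8 sum mu^2)], this bounds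
    [q * nu A] by [exp (- e^2 / (16 sum mu^2))], where [q = 1 - nu A_e].  As
    [q <= 1/2 <= nu A], the same quantity bounds [q^2], and taking square roots
    gives the constant 32 without a prefactor. *)

Require Import Defs.
From mathcomp Require Import all_boot all_order all_algebra all_fingroup.
From mathcomp Require Import all_classical all_reals all_analysis.
From mathcomp Require Import generic_quotient ring lra.

Import Order.TTheory GRing.Theory Num.Theory.

Local Open Scope classical_set_scope.
Local Open Scope ring_scope.

(** * The bound [cosh b <= exp (b^2)] *)

(** For [b >= 1] both exponentials are at most [expR (b ^+ 2)]. For [b < 1], [1 + x <= expR x] at
    half the exponent gives rational bounds, leaving a polynomial inequality in [(b / 2) ^+ 2]. *)
Lemma expRD_expRN_le [R : realType] [b : R] :
  0 <= b -> expR b + expR (- b) <= 2 * expR (b ^+ 2).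
Proof.
move=> b0; have [b1|b1] := leP 1 b.
  have hb : expR b <= expR (b ^+ 2) by rewrite ler_expR ler_eXnr.
  have hn : expR (- b) <= expR b by rewrite ler_expR; lra.
  lra.
have half (c : R) : expR c = expR (c / 2) ^+ 2.
  by rewrite -expRM_natl; congr expR; field.
have sq_le (c : R) : c < 2 -> expR c <= (1 - c / 2) ^- 2.
  move=> c2; have p : 0 < 1 - c / 2 by lra.
  have h : expR (c / 2) <= (1 - c / 2)^-1.
    rewrite -[leLHS]invrK -expRN lef_pV2 ?posrE ?expR_gt0 //.
    exact: expR_ge1Dx (- (c / 2)).
  by rewrite half -exprVn ler_pXn2r ?nnegrE ?expR_ge0 ?invr_ge0 // ltW.
pose u := b / 2.
have u0 : 0 <= u by rewrite divr_ge0.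
have u1 : u < 1 / 2 by rewrite /u; lra.
have h1 : expR b <= (1 - u) ^- 2 by apply: sq_le; lra.
have h2 : expR (- b) <= (1 + u) ^- 2.
  by have := sq_le (- b); rewrite mulNr opprK; apply; lra.
have h3 : (1 + 2 * u ^+ 2) ^+ 2 <= expR (b ^+ 2).
  have -> : 2 * u ^+ 2 = b ^+ 2 / 2 by rewrite /u; field.
  rewrite [leRHS]half ler_pXn2r ?nnegrE ?expR_ge0 ?expR_ge1Dx //.
  by rewrite addr_ge0 // divr_ge0 ?sqr_ge0.
suff h4 : (1 - u) ^- 2 + (1 + u) ^- 2 <= 2 * (1 + 2 * u ^+ 2) ^+ 2 by lra.
have n1 : 1 - u != 0 by rewrite gt_eqF //; lra.
have n2 : 1 + u != 0 by rewrite gt_eqF //; lra.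
have w0 : 0 <= u ^+ 2 by exact: sqr_ge0.
have w1 : u ^+ 2 <= 1 / 4 by nra.
have -> : (1 - u) ^- 2 + (1 + u) ^- 2 = 2 * (1 + u ^+ 2) / (1 - u ^+ 2) ^+ 2.
  have n3 : 1 - u ^+ 2 != 0 by rewrite gt_eqF //; lra.
  by field; rewrite n1 n2 n3.
move: (u ^+ 2) w0 w1 => w w0 w1.
rewrite ler_pdivrMr ?exprn_gt0 //; last by lra.
rewrite -subr_ge0.
have -> : 2 * (1 + 2 * w) ^+ 2 * (1 - w) ^+ 2 - 2 * (1 + w) =
  2 * w * (1 - 3 * w - 4 * w ^+ 2 + 4 * w ^+ 3) by ring.
apply: mulr_ge0; first by lra.
(* For [w <= 1/4] the bracket is at least [1 - 3/4 - 1/4 = 0]. *)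
have w2 : w ^+ 2 <= 1 / 16 by nra.
have w3 : 0 <= w ^+ 3 by exact: exprn_ge0.
lra.
Qed.

(** * Fibres of evaluation at a point *)

Section perm_on_fibres.
Local Open Scope group_scope.
Context [T : finType] [D : {set T}] [x : T] (xD : x \in D).

Lemma sub_perm_on [A B : {set T}] [s : {perm T}] :
  A \subset B -> perm_on A s -> perm_on B s.
Proof. by move=> AB sA; apply: fintype.subset_trans AB. Qed.

Lemma perm_onM_tperm [y z : T] [s : {perm T}] : y \in D -> z \in D ->
  perm_on D s -> perm_on D (s * tperm y z).
Proof.
move=> yD zD sD; apply: perm_onM => //; apply: sub_perm_on (tperm_on y z).
by apply/fintype.subsetP => w; rewrite !inE => /orP[]/eqP->.
Qed.

Lemma perm_on_setD1 (s : {perm T}) :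
  perm_on (D :\ x)%SET s = perm_on D s && (s x == x).
Proof.
apply/idP/andP => [sD|[sD /eqP sx]].
  split; first by apply: sub_perm_on sD; exact: subD1set.
  by apply/eqP/(out_perm sD); rewrite !inE eqxx.
apply/fintype.subsetP => y; rewrite !inE => sy.
rewrite (fintype.subsetP sD) ?inE // andbT.
by apply: contra_neq sy => ->.
Qed.

(** Right multiplication by [tperm x y] maps the stabiliser of [x] bijectively onto the fibre
    [s x = y]. *)
Lemma big_perm_on_setD1 [R : nmodType] (F : {perm T} -> R) :
  (\sum_(s | perm_on D s) F s =
   \sum_(y in D) \sum_(s | perm_on (D :\ x)%SET s) F (s * tperm x y)%g)%R.
Proof.
rewrite (partition_big (fun s : {perm T} => s x) (mem D)) /=; last first.
  by move=> s sD; rewrite perm_closed.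
apply: eq_bigr => y yD; rewrite (reindex_inj (mulIg (tperm x y))) /=.
apply: eq_bigl => s; rewrite perm_on_setD1; apply/andP/andP => -[h1 /eqP h2].
  split; last first.
    by apply/eqP/(@perm_inj _ (tperm x y)); rewrite tpermL -permM.
  rewrite -[s](mulgK (tperm x y)) tpermV; exact: perm_onM_tperm.
by split; [exact: perm_onM_tperm | rewrite permM h2 tpermL].
Qed.

End perm_on_fibres.

(** * Exponential moments on a symmetric group *)

(** With [c = r1 / r2] the left side is at most [(c + c^-1) * K], and [c] lies in
    [[exp (- b), exp b]], where [c + c^-1] is largest at the ends. *)
Lemma cross_ratio_le [R : realType] [b K r1 r2 q1 q2 : R] :
  0 <= b -> 0 < r1 -> 0 < r2 -> r1 <= expR b * r2 -> r2 <= expR b * r1 ->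
  r1 * q1 <= K -> r2 * q2 <= K -> 0 <= K ->
  r1 * q2 + r2 * q1 <= 2 * (K * expR (b ^+ 2)).
Proof.
move=> b0 p1 p2 le12 le21 K1 K2 K0.
pose c := r1 / r2; have c0 : 0 < c by rewrite divr_gt0.
have e1 : r1 * q2 <= c * K.
  by rewrite /c mulrAC -mulrA ler_pM2l // ler_pdivlMr // mulrC.
have e2 : r2 * q1 <= c^-1 * K.
  by rewrite /c invf_div mulrAC -mulrA ler_pM2l // ler_pdivlMr // mulrC.
have cb : c <= expR b by rewrite ler_pdivrMr.
have bc : expR (- b) <= c.
  by rewrite expRN ler_pdivlMr // mulrC ler_pdivrMr ?expR_gt0 // mulrC.
suff h : c + c^-1 <= 2 * expR (b ^+ 2).
  apply: le_trans (lerD e1 e2) _; rewrite -mulrDl.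
  by apply: le_trans (ler_wpM2r K0 h) _; rewrite -mulrA [_ * K]mulrC.
apply: le_trans (expRD_expRN_le b0); rewrite expRN in bc *.
have E0 := expR_gt0 b; rewrite -subr_ge0.
have -> : expR b + (expR b)^-1 - (c + c^-1) = (expR b - c) * (c - (expR b)^-1) / c.
  have [cn En] : c != 0 /\ expR b != 0 by rewrite !gt_eqF.
  by field; rewrite ?cn ?En.
by apply: divr_ge0; [apply: mulr_ge0; rewrite subr_ge0 | exact: ltW].
Qed.

Lemma sum_le_pair [R : realType] [T : finType] [mu : T -> R] [P : pred T]
    [x y : T] : (forall z, 0 <= mu z) -> (forall z, P z -> z = x \/ z = y) ->
  \sum_(z | P z) mu z <= mu x + mu y.
Proof.
move=> mu0 Pxy; have sum1 w : mu w = \sum_z if z == w then mu z else 0.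
  by rewrite -big_mkcond big_pred1_eq.
rewrite (sum1 x) (sum1 y) -big_split /= big_mkcond /=.
apply: ler_sum => z _; case: ifP => [/Pxy[]->|_]; rewrite ?eqxx.
- by rewrite lerDl; case: ifP.
- by rewrite lerDr; case: ifP.
- by rewrite addr_ge0 //; case: ifP.
Qed.

(** The weights are arbitrary so that they can absorb the parameter l of the exponential moments. *)
Lemma laplace_perm_on [R : realType] [T : finType] [mu : T -> R]
    [D : {set T}] [f : {perm T} -> R] :
  (forall x, 0 <= mu x) ->
  (forall s t, perm_on D s -> perm_on D t ->
    f s <= f t + \sum_(x | s x != t x) mu x) ->
  (\sum_(s | perm_on D s) expR (f s)) * (\sum_(s | perm_on D s) expR (- f s)) <=
  (\sum_(s : {perm T} | perm_on D s) 1) ^+ 2 *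
    expR (4 * \sum_(x in D) mu x ^+ 2).
Proof.
move=> mu0; have [n] := ubnP #|D|; elim: n D f => // n IHn D f Dn lipf.
have [D0|[x0 x0D]] := finset.set_0Vmem D.
  have on1 s : perm_on D s = (s == 1%g).
    apply/idP/eqP => [sD|->]; last exact: perm_on1.
    by apply/permP => x; rewrite perm1 (out_perm sD) // D0 inE.
  rewrite !(eq_bigl _ _ on1) !big_pred1_eq D0 big_set0 mulr0 expR0 -expRD.
  by rewrite subrr expR0 expr1n mul1r.
have [x xD xmax] := arg_maxP mu x0D; rewrite -/(x \in D) in xD.
have D'n : (#|D :\ x| < n)%N by rewrite (cardsD1 x D) xD in Dn.
set D' := (D :\ x)%SET in D'n *.
have D'P s : perm_on D' s = perm_on D s && (s x == x) by exact: perm_on_setD1.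
have onD y s : y \in D -> perm_on D' s -> perm_on D (s * tperm x y)%g.
  by rewrite D'P => yD /andP[sD _]; exact: perm_onM_tperm.
(* The two exponential moments over the fibre [s x = y]. *)
pose r y := \sum_(s | perm_on D' s) expR (f (s * tperm x y)%g).
pose q y := \sum_(s | perm_on D' s) expR (- f (s * tperm x y)%g).
pose N : R := \sum_(s : {perm T} | perm_on D' s) 1.
pose K := N ^+ 2 * expR (4 * \sum_(y in D') mu y ^+ 2).
(* A common right factor does not change where two permutations differ, so the induction hypothesis
   applies to each fibre. *)
have rq y : y \in D -> r y * q y <= K.
  move=> yD; apply: (IHn D' (fun s => f (s * tperm x y)%g)) => // s t sD tD.
  apply: le_trans (lipf _ (t * tperm x y)%g _ _) _; rewrite ?onD // lerD2l.
  by under eq_bigl do rewrite !permM (inj_eq perm_inj).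
have r_gt0 y : 0 < r y.
  rewrite /r (bigD1 1%g) ?perm_on1 //= ltr_wpDr ?expR_gt0 //.
  by apply: sumr_ge0 => s _; exact: expR_ge0.
have r_ratio y z : y \in D -> z \in D -> r z <= expR (2 * mu x) * r y.
  (* [c] fixes [x]; reindexing by it matches the fibres over [y] and [z] through composition with
     [tperm y z]. *)
  move=> yD zD; pose c := (tperm x y * tperm y z * tperm x z)%g.
  have cD : perm_on D' c.
    rewrite D'P !perm_onM_tperm //=; last first.
      by apply: sub_perm_on (tperm_on x y); apply/fintype.subsetP => w;
         rewrite !inE => /orP[]/eqP->.
    by rewrite !permM tpermL tpermL tpermR.
  rewrite /r (reindex_inj (mulIg c)) /= mulr_sumr.
  rewrite (eq_bigl (perm_on D')); last first.
    move=> s; apply/idP/idP => [sc|sD]; last exact: perm_onM.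
    by rewrite -[s](mulgK c); apply: perm_onM => //; exact: perm_onV.
  apply: ler_sum => s sD; rewrite -expRD ler_expR.
  have -> : (s * c * tperm x z = s * tperm x y * tperm y z)%g.
    by rewrite /c !mulgA -[X in X = _]mulgA tperm2 mulg1.
  set t := (s * tperm x y)%g; have tD : perm_on D t by exact: onD.
  have tx : t x = y.
    by move: sD; rewrite D'P => /andP[_ /eqP sx]; rewrite permM sx tpermL.
  rewrite [leRHS]addrC; apply: le_trans (lipf _ t _ tD) _;
    first exact: perm_onM_tperm.
  (* The two permutations differ at most at [x], the preimage of [y], and at [w], the preimage of
     [z]; maximality gives [mu w <= mu x]. *)
  rewrite lerD2l; set w := (t^-1)%g z.
  have wD : w \in D by rewrite -(perm_closed w tD) permKV.
  apply: (@le_trans _ _ (mu x + mu w)); last first.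
    by rewrite mulr_natl mulr2n lerD2l; exact: xmax.
  apply: sum_le_pair => // v; rewrite permM.
  case: tpermP => [tv _|tv _|_ _ /eqP//].
    by left; apply: (@perm_inj _ t); rewrite tx.
  by right; apply: (@perm_inj _ t); rewrite permKV.
have -> : (\sum_(s : {perm T} | perm_on D s) 1 : R) = #|D|%:R * N.
  by rewrite (big_perm_on_setD1 xD) /= sumr_const mulr_natl.
have -> : \sum_(s | perm_on D s) expR (f s) = \sum_(y in D) r y.
  exact: big_perm_on_setD1.
have -> : \sum_(s | perm_on D s) expR (- f s) = \sum_(y in D) q y.
  exact: (big_perm_on_setD1 xD (fun s => expR (- f s))).
rewrite [\sum_(y in D) mu y ^+ 2](big_setD1 x) //= -/D' big_distrlr /=.
(* [b ^+ 2] is exactly the term of [x] in the exponent [4 * \sum mu ^+ 2]. *)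
pose b := 2 * mu x.
have b0 : 0 <= b by rewrite mulr_ge0.
have K0 : 0 <= K by rewrite mulr_ge0 ?sqr_ge0 ?expR_ge0.
have -> : (#|D|%:R * N) ^+ 2 *
    expR (4 * (mu x ^+ 2 + \sum_(y in D') mu y ^+ 2)) =
    #|D|%:R ^+ 2 * (K * expR (b ^+ 2)).
  rewrite mulrDr expRD (_ : b ^+ 2 = 4 * mu x ^+ 2) /K; first by ring.
  by rewrite /b; ring.
(* Doubling the double sum pairs [r y * q z] with [r z * q y], as [cross_ratio_le] requires. *)
rewrite -(@ler_pM2l _ 2) //.
rewrite mulr_natl mulr2n {2}exchange_big /= -big_split /=.
rewrite [leRHS](_ : _ = \sum_(y in D) \sum_(z in D) 2 * (K * expR (b ^+ 2))).
  apply: ler_sum => y yD; rewrite -big_split; apply: ler_sum => z zD /=.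
  by apply: cross_ratio_le => //; [exact: r_ratio|exact: r_ratio|exact: rq|exact: rq].
by rewrite !sumr_const -mulrnA -[RHS]mulr_natl natrM; ring.
Qed.

(** * Classes of nonsingular maps as permutations of the support *)

Section finite_probability.
Context [R : realType] [d : measure_display] [X : finMeasurableType d].
Variable mu : probability X R.

Lemma mass_ge0 (x : X) : 0 <= fine (mu [set x]).
Proof. exact: fine_ge0. Qed.

Lemma fine_measure_sum (P : pred X) :
  fine (mu [set x | P x]) = \sum_(x | P x) fine (mu [set x]).
Proof.
have fin A : mu A \is a fin_num.
  by rewrite fin_num_measure //; exact: finmeasurable.
have -> : [set x | P x] = [set x | x \in enum P].
  by apply/seteqP; split=> x /=; rewrite mem_enum.
rewrite -[RHS]big_enum /=; have := enum_uniq P.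
elim: (enum P) => [|y r IHr] /=.
  by rewrite big_nil set_nil measure0.
move=> /andP[yr /IHr {}IHr]; rewrite big_cons -IHr -fineD //.
rewrite -measureU //; try exact: finmeasurable.
  by congr (fine (mu _)); apply/seteqP; split=> x /=; rewrite in_cons;
    [move=> /orP[/eqP|]; [left|right] | move=> [->|->]; rewrite ?eqxx ?orbT].
by apply/seteqP; split=> x //= -[->]; rewrite (negPf yr).
Qed.

Definition mass_support : {set X} := [set x | fine (mu [set x]%classic) != 0]%SET.

Lemma measure_eq0P (A : set X) :
  mu A = 0%E <-> (forall x, A x -> x \notin mass_support).
Proof.
have fin B : mu B \is a fin_num.
  by rewrite fin_num_measure //; exact: finmeasurable.
have -> : A = [set x | `[< A x >]] by apply/seteqP; split=> x /asboolP.
rewrite -[mu _]fineK // fine_measure_sum; split.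
  move=> [/eqP]; rewrite psumr_eq0; last by move=> x _; exact: mass_ge0.
  move=> /allP h x Ax; rewrite inE negbK.
  by have /implyP/(_ Ax) := h x (mem_index_enum x).
move=> h; congr EFin; apply: big1 => x Ax.
by apply/eqP; have := h x Ax; rewrite inE negbK.
Qed.

(** Testing on the singleton of [s x], whose preimage is that of [x], shows that [s] preserves the
    support. *)
Lemma nonsingularP (s : {perm X}) :
  reflect (forall x, (s x \in mass_support) = (x \in mass_support))
    (nonsingular mu s).
Proof.
apply: (iffP (asboolP _)) => [h x|h A _].
  have := h [set s x] (finmeasurable _).
  rewrite !measure_eq0P => -[h1 h2]; apply/idP/idP; apply: contraLR => hx.
    by apply: h1 => //= y /perm_inj ->.
  by apply: h2 => //= y ->.
rewrite !measure_eq0P; split=> hA x /= Ax.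
  by rewrite -(permKV s x) h; apply: hA => /=; rewrite permKV.
by rewrite -h; exact: hA.
Qed.

Lemma perm_on_nonsingular (s : {perm X}) :
  perm_on mass_support s -> nonsingular mu s.
Proof. by move=> sP; apply/nonsingularP => x; rewrite perm_closed. Qed.

(* The permutations of the support represent every class exactly once; junk
   value, the class of 1, on singular permutations. *)
Definition Autstar_of_perm (s : {perm X}) : Autstar mu :=
  \pi_(Autstar mu)%qT (insubd (exist _ 1%g (nonsingular1 mu)) s : nonsing mu).

Lemma dunif_of_perm (s t : {perm X}) :
  perm_on mass_support s -> perm_on mass_support t ->
  dunif (Autstar_of_perm s) (Autstar_of_perm t) =
  \sum_(x | s x != t x) fine (mu [set x]).
Proof.
move=> sP tP; rewrite dunif_pi -fine_measure_sum.
by rewrite /nonsing_fun !insubdK //; exact: perm_on_nonsingular.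
Qed.

(** Equality almost everywhere is equality on the support, so restricting a representative to the
    support inverts [Autstar_of_perm]. *)
Lemma big_Autstar [V : nmodType] (F : Autstar mu -> V) :
  \sum_a F a = \sum_(s | perm_on mass_support s) F (Autstar_of_perm s).
Proof.
pose h' (a : Autstar mu) : {perm X} := restr_perm mass_support (val (repr a)).
(* [restr_perm] is the restriction only for permutations that stabilise the set. *)
have stab (s : nonsing mu) : val s \in ('N(mass_support | 'P))%g.
  apply/astabsP => x /=; rewrite apermE; apply/nonsingularP; exact: valP.
have h'E (s : nonsing mu) x : x \in mass_support ->
  h' (\pi_(Autstar mu)%qT s) x = val s x.
  move=> xP; rewrite /h' restr_permE //.
  have /Autstar_eqP/ae_disagree/measure_eq0P/(_ x) :=
    reprK (\pi_(Autstar mu)%qT s).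
  by move=> h; apply/eqP; apply: contraLR xP; exact: h.
have ofK s : perm_on mass_support s -> h' (Autstar_of_perm s) = s.
  move=> sP; apply/permP => x; have [xP|xP] := boolP (x \in mass_support).
    by rewrite h'E // insubdK //; exact: perm_on_nonsingular.
  by rewrite !(out_perm _ xP) //; exact: restr_perm_on.
rewrite (reindex_onto Autstar_of_perm h') /=.
  apply: eq_bigl => s; apply/eqP/idP => [<-|/ofK//]; exact: restr_perm_on.
move=> a _; rewrite -[RHS]reprK; apply/Autstar_eqP/ae_disagree/measure_eq0P => x /=.
rewrite /nonsing_fun insubdK; last by apply: perm_on_nonsingular; exact: restr_perm_on.
by apply: contra => xP; rewrite /h' restr_permE.
Qed.

End finite_probability.

(** * Separated sets in the automorphism group *)

Section Autstar_concentration.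
Context [R : realType] [d : measure_display] [X : finMeasurableType d].
Variable mu : probability X R.

Local Notation S := (\sum_(x : X) fine (mu [set x]) ^+ 2).

Lemma laplace_Autstar [l : R] [f : Autstar mu -> R] : 0 <= l ->
  (forall a b, f a <= f b + dunif a b) ->
  (\sum_a expR (l * f a)) * (\sum_a expR (- (l * f a))) <=
  #|{: Autstar mu}|%:R ^+ 2 * expR (4 * (l ^+ 2 * S)).
Proof.
move=> l0 lipf.
have -> : #|{: Autstar mu}|%:R = \sum_(a : Autstar mu) 1 :> R.
  by rewrite sumr_const.
rewrite !big_Autstar.
have m0 x : 0 <= l * fine (mu [set x]) by rewrite mulr_ge0 ?mass_ge0.
apply: le_trans (laplace_perm_on (mu := fun x => l * fine (mu [set x])) m0 _) _.
  move=> s t sP tP; rewrite -mulr_sumr -dunif_of_perm // -mulrDr.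
  by rewrite ler_wpM2l.
rewrite ler_wpM2l ?sqr_ge0 // ler_expR ler_pM2l // mulr_sumr.
rewrite big_mkcond; apply: ler_sum => x _ /=; rewrite exprMn.
by case: ifP => // _; rewrite mulr_ge0 ?sqr_ge0.
Qed.

Lemma normalized_countingE (A : set (Autstar mu)) :
  normalized_counting mu A =
  ((\sum_(a | a \in A) 1) / #|{: Autstar mu}|%:R)%:E.
Proof.
rewrite /normalized_counting /mscale /= /counting asboolT; last exact: finite_finset.
rewrite -EFinM mulrC; congr (_ / _)%:E.
rewrite sumr_const; congr _%:R.
rewrite -(card_uniqP (finmap.fset_uniq _)); apply: eq_card => a.
by rewrite in_fset_set //; exact: finite_finset.
Qed.

Lemma normalized_counting_le (A B : set (Autstar mu)) : A `<=` B ->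
  fine (normalized_counting mu A) <= fine (normalized_counting mu B).
Proof.
move=> AB; rewrite !normalized_countingE /= ler_wpM2r ?invr_ge0 //.
rewrite big_mkcond [leRHS]big_mkcond; apply: ler_sum => a _ /=.
by case: ifPn => [/set_mem/AB/mem_set->//|_]; case: ifP.
Qed.

Lemma normalized_countingC (A : set (Autstar mu)) :
  fine (normalized_counting mu (~` A)) = 1 - fine (normalized_counting mu A).
Proof.
rewrite !normalized_countingE /=.
have N0 : #|{: Autstar mu}|%:R != 0 :> R.
  by rewrite pnatr_eq0 -lt0n; apply/card_gt0P; exists point.
apply: (mulIf N0); rewrite mulrBl mul1r !divfK //.
have -> : #|{: Autstar mu}|%:R = \sum_(a : Autstar mu) 1 :> R.
  by rewrite sumr_const.
rewrite [\sum_a 1](bigID (fun a => a \in A)) /= [RHS]addrC addKr.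
by apply: eq_bigl => a; rewrite in_setC.
Qed.

(** The truncated distance [f] to [A] is at most 0 on [A] and at least [e] on [B], so its two
    exponential moments dominate [#|A|] and [#|B| * expR (l * e)]. *)
Lemma normalized_counting_separated [A B : set (Autstar mu)] [e : R] :
  0 < e -> 0 < S -> (forall a b, A a -> B b -> e <= dunif b a) ->
  fine (normalized_counting mu A) * fine (normalized_counting mu B) <=
  expR (- (e ^+ 2 / (16 * S))).
Proof.
move=> e0 S0 AB; rewrite !normalized_countingE /=.
(* This value minimises [4 * l ^+ 2 * S - l * e], with minimum [- e ^+ 2 / (16 * S)]. *)
pose l := e / (8 * S); have l0 : 0 < l by rewrite divr_gt0 ?mulr_gt0.
(* The default [e] truncates the distance and covers empty [A]. *)
pose f (b : Autstar mu) := \big[Num.min/e]_(a | a \in A) dunif b a.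
have dunif_ge0 (a b : Autstar mu) : 0 <= dunif a b by exact: fine_ge0.
have lipf a b : f a <= f b + dunif a b.
  rewrite -lerBlDr; apply: le_bigmin => [|c Ac].
    by rewrite lerBlDr; apply: le_trans (bigmin_le_id _ _ _ _) _; rewrite lerDl.
  rewrite lerBlDr; apply: le_trans (bigmin_le_cond _ _ Ac) _.
  by rewrite addrC; exact: (@metric_triangle _ (Autstar mu)).
have fA a : a \in A -> f a <= 0.
  move=> Aa; apply: le_trans (bigmin_le_cond _ _ Aa) _.
  by have -> : dunif a a = 0 by exact: (@mdistxx _ (Autstar mu)).
have fB b : b \in B -> e <= f b.
  by move=> /set_mem Bb; apply: le_bigmin => // a /set_mem Aa; exact: AB.
set N := #|{: Autstar mu}|%:R : R.
have N0 : 0 < N by rewrite ltr0n; apply/card_gt0P; exists point.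
have cA : \sum_(a | a \in A) 1 <= \sum_a expR (- (l * f a)).
  rewrite big_mkcond; apply: ler_sum => a _; case: ifP => Aa; last exact: expR_ge0.
  by rewrite -expR0 ler_expR oppr_ge0 pmulr_rle0 // fA.
have cB : (\sum_(b | b \in B) 1) * expR (l * e) <= \sum_a expR (l * f a).
  rewrite mulr_suml big_mkcond; apply: ler_sum => b _.
  case: ifP => Bb; last exact: expR_ge0.
  by rewrite mul1r ler_expR ler_pM2l // fB.
have := laplace_Autstar (ltW l0) lipf.
have -> : 4 * (l ^+ 2 * S) = l * e - e ^+ 2 / (16 * S).
  by rewrite /l; field; rewrite gt_eqF.
rewrite -/N expRD => h.
rewrite mulrACA -invfM -expr2 ler_pdivrMr ?exprn_gt0 //.
rewrite -(ler_pM2r (expR_gt0 (l * e))).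
rewrite [leRHS](_ : _ = N ^+ 2 * (expR (l * e) * expR (- (e ^+ 2 / (16 * S))))).
  apply: le_trans h; rewrite -mulrA mulrC.
  by apply: ler_pM => //; rewrite ?mulr_ge0 ?expR_ge0 ?sumr_ge0.
by rewrite -mulrA mulrC -mulrA.
Qed.

End Autstar_concentration.
Arguments normalized_counting_separated [R d X mu A B e].

(** * Passage to the concentration function *)

Theorem theorem2p12 (R : realType) (d : measure_display)
    (X : finMeasurableType d) (mu : probability X R) (e : R) :
  0 < e ->
  concentration (normalized_counting mu) e <=
    expR (- (e ^+ 2 / (32 * \sum_(x : X) fine (mu [set x]) ^+ 2))).
Proof.
move=> e0; rewrite /concentration gt_eqF //.
set S := \sum_(x : X) _.
have fin (A : set (borel (Autstar mu))) : normalized_counting mu A \is a fin_num.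
  by rewrite normalized_countingE.
have half A : (2^-1%:E <= normalized_counting mu A)%E =
    (2^-1 <= fine (normalized_counting mu A)).
  by rewrite -[X in (_ <= X)%E]fineK ?fin.
(* A lower bound passes to the infimum of a nonempty set; the whole space is a witness. *)
rewrite lerBlDl -lerBlDr; apply: lb_le_inf.
  exists (fine (normalized_counting mu (eps_nbhd setT e))), setT => //=.
  split; first exact: measurableT.
  by rewrite probability_setT lee_fin invf_le1 // ler1n.
move=> _ [A [_]] /= + <-; rewrite half.
set p := fine _ => Ahalf; set q := fine _; rewrite lerBlDr -lerBlDl.
pose B : set (Autstar mu) := ~` eps_nbhd A e.
have Bq : fine (normalized_counting mu B) = 1 - q.
  exact: normalized_countingC.
have pq : p <= q.
  by apply: normalized_counting_le => a Aa; exists a; rewrite ?mdistxx.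
have S_ge0 : 0 <= S by apply: sumr_ge0 => x _; exact: sqr_ge0.
have [S0|S0] := eqVneq S 0.
  (* Here [0^-1 = 0] makes the right side [expR 0 = 1]. *)
  by rewrite S0 mulr0 invr0 mulr0 oppr0 expR0; lra.
have {S_ge0}S0 : 0 < S by rewrite lt_neqAle eq_sym S0.
have sep a b : A a -> B b -> e <= dunif b a.
  by move=> Aa Bb; rewrite leNgt; apply/negP => ba; apply: Bb; exists a.
have := normalized_counting_separated e0 S0 sep; rewrite -/p Bq.
have -> : - (e ^+ 2 / (16 * S)) = 2%:R * (- (e ^+ 2 / (32 * S))).
  by field; rewrite gt_eqF.
rewrite expRM_natl => h.
have [q1|q1] := leP (1 - q) 0; first by rewrite (le_trans q1) ?expR_ge0.
(* Compare squares: [1 - q <= 1/2 <= p] gives [(1 - q) ^+ 2 <= p * (1 - q)]. *)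
rewrite -(@ler_pXn2r _ 2) ?nnegrE ?expR_ge0 ?(ltW q1) //.
by apply: le_trans h; rewrite expr2 ler_wpM2r ?(ltW q1) //; lra.
Qed.
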